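(* For every integer $k\ge 0$ and every integer $r\ge 2$, the class $\mathcal{G}_k(r^2+r+3,\,r+2,\,r)$ contains graphs of arbitrarily large diameter; in particular, it contains infinitely many pairwise nonisomorphic graphs. Each graph in this class has $Q$-main polynomial $$x\bigl(x^2-(r^2+r+3)x+(r+2)\bigr).$$
   Context: All graphs are finite, simple, connected, undirected, and have at least one edge. For a graph $G$, $A(G)$ is the adjacency matrix, $D(G)$ the diagonal matrix of vertex degrees, and $Q(G)=A(G)+D(G)$ is the signless Laplacian; $\mathbf{1}$ is the all-ones vector. An eigenvalue $\lambda$ of $Q(G)$ is $Q$-main if its eigenspace is not orthogonal to $\mathbf{1}$. If the distinct $Q$-main eigenvalues of $G$ are $\lambda_1,\ldots,\lambda_m$, the $Q$-main polynomial of $G$ is $\prod_{i=1}^{m}(x-\lambda_i)$. The cyclomatic number of $G$ is $|E(G)|-|V(G)|+1$. The sign vector of an ordered bipartition $V(G)=V_+\sqcup V_-$ is $\sigma\in\{1,-1\}^{V(G)}$ with $\sigma(v)=1$ for $v\in V_+$ and $\sigma(v)=-1$ for $v\in V_-$. For $a,b\in\mathbb{Z}$ and $t\in\mathbb{Z}_{>0}$, a bipartite graph $G$ with ordered bipartition $V_+\sqcup V_-$ and sign vector $\sigma$ satisfies the $(a,b,t)$-signed degree-sum equation if $Q^2\mathbf{1}-aQ\mathbf{1}+b\mathbf{1}=t\sigma$, where $Q=Q(G)$. The class $\mathcal{G}(a,b,t)$ consists of the bipartite graphs with bipartition classes of unequal cardinalities, labelled so that $|V_+|>|V_-|$, that have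 exactly three distinct $Q$-main eigenvalues, one of which is zero, and satisfy the $(a,b,t)$-signed degree-sum equation. The class $\mathcal{G}_k(a,b,t)$ consists of the graphs in $\mathcal{G}(a,b,t)$ with cyclomatic number $k$. *)

(* Defs.v *)
From mathcomp Require Import all_boot all_order all_algebra.
From mathcomp Require Import polyrcf reals.

Set Implicit Arguments.
Unset Strict Implicit.
Unset Printing Implicit Defensive.

Import Order.TTheory GRing.Theory Num.Theory.

Local Open Scope ring_scope.

Record graph := Graph {
  vertex :> finType;
  adj : rel vertex;
  adj_sym : symmetric adj;
  adj_irrefl : irreflexive adj;
  adj_connected : forall x y : vertex, connect adj x y;
  adj_edge : exists x y : vertex, adj x y
}.

Definition isomorphic (G H : graph) : Prop :=
  exists f : G -> H, bijective f /\ forall x y : G, adj (f x) (f y) = adj x y.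

Section Invariants.
Variable G : graph.

Definition edges : {set {set G}} :=
  [set [set u.1; u.2] | u in [set u : G * G | adj u.1 u.2]].

Definition deg (x : G) : nat := #|[set y | adj x y]|.

Definition cyclomatic : int := #|edges|%:Z - #|G|%:Z + 1.

Definition walk (x y : G) (n : nat) : bool :=
  [exists p : n.-tuple G, path (@adj G) x p && (last x p == y)].

Lemma walk_ex (x y : G) : exists n, walk x y n.
Proof.
have /connectP[p px ->] := adj_connected x y.
by exists (size p); apply/existsP; exists (in_tuple p); rewrite px eqxx.
Qed.

Definition dist (x y : G) : nat := ex_minn (walk_ex x y).

Definition diameter : nat := \max_(x : G) \max_(y : G) dist x y.

(* An ordered bipartition is given by V_+; then V_- is the complement. *)
Definition bipartition (Vp : {set G}) : Prop :=
  forall x y : G, adj x y -> (x \in Vp) != (y \in Vp).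

End Invariants.

Section SignlessLaplacian.
Variables (R : realType) (G : graph).

(* Matrices over G have their rows and columns indexed along enum_val. *)
Definition adjacency_mx : 'M[R]_#|G| :=
  \matrix_(i, j) (adj (enum_val i) (enum_val j))%:R.

Definition degree_mx : 'M[R]_#|G| :=
  diag_mx (\row_i (deg (enum_val i))%:R).

Definition Qmx : 'M[R]_#|G| := adjacency_mx + degree_mx.

Definition ones : 'cV[R]_#|G| := const_mx 1.

Definition sign_vector (Vp : {set G}) : 'cV[R]_#|G| :=
  \col_i (if enum_val i \in Vp then 1 else -1).

(* The rows of eigenspace Qmx x span the row eigenspace of Qmx, which is also
   the column eigenspace since Qmx is symmetric. *)
Definition Qmain (x : R) : bool :=
  eigenvalue Qmx x && (eigenspace Qmx x *m ones != 0).

(* Duplicate-free, as rootsR lists the distinct roots in R. *)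
Definition Qmain_eigenvalues : seq R :=
  [seq x <- rootsR (char_poly Qmx) | Qmain x].

Definition Qmain_poly : {poly R} :=
  \prod_(x <- Qmain_eigenvalues) ('X - x%:P).

Lemma mem_Qmain_eigenvalues x : (x \in Qmain_eigenvalues) = Qmain x.
Proof.
rewrite mem_filter -roots_on_rootsR ?monic_neq0 ?char_poly_monic //.
rewrite in_itv /= -eigenvalue_root_char.
by apply: andb_idr => /andP[].
Qed.

Lemma Qmain_eigenvalues_uniq : uniq Qmain_eigenvalues.
Proof. exact/filter_uniq/uniq_roots. Qed.

Definition signed_degree_sum (a b t : int) (Vp : {set G}) : Prop :=
  Qmx *m (Qmx *m ones) - a%:~R *: (Qmx *m ones) + b%:~R *: ones
    = t%:~R *: sign_vector Vp.

Definition in_class (a b t : int) : Prop :=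
  [/\ 0 < t,
      size Qmain_eigenvalues = 3%N,
      0 \in Qmain_eigenvalues &
      exists Vp : {set G},
        [/\ bipartition Vp, (#|~: Vp| < #|Vp|)%N
          & signed_degree_sum a b t Vp]].

Definition in_class_cyc (k a b t : int) : Prop :=
  in_class a b t /\ cyclomatic G = k.

End SignlessLaplacian.

(* Main.v *)
Require Import Defs.
From mathcomp Require Import all_boot all_order all_algebra.
From mathcomp Require Import reals boolp.
From mathcomp Require Import zify ring lra.

(** Write [s(v)] for the sum of the degrees of the neighbours of [v].  Since
    [Q 1 = 2 d] and [Q^2 1 = 2 (s + d^2)], the signed degree-sum equation with
    parameters [(r^2+r+3, r+2, r)] says that
      [s(v) + d(v)^2 + 1 = (r^2+r+3) d(v)]      on [V_+],
      [s(v) + d(v)^2 + 1 + r = (r^2+r+3) d(v)]  on [V_-].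

    The spectral half is formal.  As [Q] kills the sign vector, the equation
    gives [Q (Q^2 - a Q + b) 1 = 0], so every Q-main eigenvalue is a root of
    [x (x^2 - a x + b)] ([Qmain_root]); a graph with three Q-main eigenvalues
    has all three roots, whence the Q-main polynomial ([Qmain_poly_cubic]).
    Conversely a bipartite graph satisfying the two displayed equations is
    always in the class ([in_class_balanced]).  Pairing the equation with the
    sign vector gives [b (|V_+| - |V_-|) = t |V|], so the larger part is [V_+]
    and [0] is Q-main.  If one of the two other roots were not Q-main, then
    [s + d^2] would be proportional to [d], the degrees would be constant on
    each part, and the equations would force [r = 0] ([not_proportional]).

    It remains to build graphs.  Suitable degrees are:
    - in [V_-]: hubs, of degree [r+1], all of whose neighbours have degree
      [r^2+1]; stars, of degree [r^2+r+1], with one neighbour of degree [r^2+1]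
      and leaves otherwise; leaves hanging at vertices of degree [r^2+1];
    - in [V_+]: vertices of degree [r^2+1], and the leaves of the stars.
    A vertex of degree [r^2+1] is in balance with [x] stars, [y] hubs and
    leaves otherwise as soon as [x (r+1) + y = r^2+r+1].  The solution
    [(x, y) = (r, 1)] ends a branch.  The solution [(r-1, r+2)] branches, and
    such vertices form a spine: consecutive ones are joined through one hub,
    which lengthens the graph, or through two hubs, which also closes a cycle
    of length four.  As [r + 2 >= 4], two hubs on each side are affordable, so
    the diameter and the cyclomatic number can be prescribed independently.

    The graphs are grown one vertex at a time.  A [stage] is a connected graph
    in which each vertex carries a list of trees still to be hung at it; the
    equations are imposed on the degrees that the vertices will have at the
    end.  The single operation [grow] adds a vertex joined to a set [A] of
    vertices, at the expense of one tree of each; it raises the cyclomatic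
    number by [|A| - 1].  When the spine is long enough, hanging all remaining
    trees ([completion]) gives the graph. *)

Set Implicit Arguments.
Unset Strict Implicit.
Unset Printing Implicit Defensive.

Import Order.TTheory GRing.Theory Num.Theory.

(** * Degrees, edges and distances in a graph *)

Section GraphFacts.
Variable G : graph.

Definition nbdeg (x : G) : nat := \sum_(y | adj x y) deg y.

(** Every edge has exactly two preimages under [(x, y) |-> {x, y}]. *)
Lemma handshake : #|[set u : G * G | adj u.1 u.2]| = 2 * #|edges G|.
Proof.
rewrite /edges; set D := [set u | _]; set f := fun u : G * G => _.
rewrite -sum1_card (partition_big_imset f) /= mulnC -sum_nat_const.
apply: eq_bigr => e /imsetP [[x y]]; rewrite inE /= => xy ->{e}.
have neq : (x, y) != (y, x).
  by apply/eqP => -[xE _]; move: xy; rewrite xE adj_irrefl.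
transitivity #|[set (x, y); (y, x)]|; last by rewrite cards2 neq.
rewrite -sum1_card; apply: eq_bigl => -[u v]; rewrite !inE /= !xpair_eqE /f /=.
apply/andP/orP => [[uv /eqP /setP e]|].
  have := e u; have := e v; rewrite !inE !eqxx orbT /=.
  case/esym/orP => /eqP vE; case/esym/orP => /eqP uE; move: uv;
    by rewrite uE vE ?adj_irrefl ?eqxx //=; auto.
by case=> /andP [/eqP -> /eqP ->]; split; rewrite // 1?adj_sym // setUC.
Qed.

(** A function that rises by at most one along each edge bounds distances from
    below. *)
Lemma diameter_ge (h : G -> nat) (x y : G) :
  (forall u v : G, adj u v -> h v <= (h u).+1) -> h y <= h x + diameter G.
Proof.
move=> h1; have walk_le n : walk x y n -> h y <= h x + n.
  case/existsP => p /andP [px /eqP <-].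
  rewrite -[X in _ <= _ + X](size_tuple p); move: px.
  elim: (tval p) x => [|z s IH] u /=; first by rewrite addn0.
  by move=> /andP [/h1 uz /IH]; lia.
have /walk_le hxy : walk x y (dist x y) by rewrite /dist; case: ex_minnP.
apply: leq_trans hxy _; rewrite leq_add2l.
apply: leq_trans (leq_bigmax y) _.
exact: (leq_bigmax (F := fun x => \max_y dist x y) x).
Qed.

End GraphFacts.

Lemma iso_card (G H : graph) : isomorphic G H -> #|G| = #|H|.
Proof. by case=> f [/bij_eq_card]. Qed.

(** * Growing a graph under pending trees *)

(** Trees to be hung at a vertex of a graph under construction. *)
Inductive tree := Node of seq tree.

Definition children t := let: Node ch := t in ch.

(** The degree of the root once the tree has been hung: the summand one counts
    the edge to the vertex carrying it. *)
Definition tdeg t := (size (children t)).+1.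

Definition tdegs ch := sumn (map tdeg ch).
Fixpoint tsize t := let: Node ch := t in (sumn (map tsize ch)).+1.

(** The parameter [r] of the class is called [q] as a natural number, and [V_+]
    will consist of the vertices of even level. *)
Definition balanced (q : nat) (odd_lvl : bool) (d s : nat) :=
  s + d ^ 2 + 1 + odd_lvl * q == (q ^ 2 + q + 3) * d.

(** The tree can be hung at a vertex of final degree [p]: all its vertices are
    then balanced.  The root is at a level of parity [odd_lvl]. *)
Fixpoint fits (q : nat) (odd_lvl : bool) (p : nat) (t : tree) : bool :=
  let: Node ch := t in
  balanced q odd_lvl (size ch).+1 (p + tdegs ch)
  && all (fits q (~~ odd_lvl) (size ch).+1) ch.

Record stage := Stage {
  vtx : finType;
  nb : rel vtx;
  lvl : vtx -> nat;
  todo : vtx -> seq tree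
}.

(** Final degree: pending trees count as neighbours, so that neither [fdeg] nor
    [fsum] of a vertex changes while the graph grows. *)
Definition fdeg (S : stage) (x : vtx S) : nat :=
  #|[set y | nb x y]| + size (todo x).

Definition fsum (S : stage) (x : vtx S) : nat :=
  \sum_(y | nb x y) fdeg y + tdegs (todo x).

(** The number of pairs counted by [nb_count] is twice the number of edges, so
    this field says that the cyclomatic number is [k]. *)
Record sound (q k : nat) (S : stage) : Prop := Sound {
  nb_sym : symmetric (@nb S);
  nb_lvl : forall x y : vtx S,
    nb x y -> (lvl y == (lvl x).+1) || (lvl x == (lvl y).+1);
  nb_connected : forall x y : vtx S, connect (@nb S) x y;
  nb_count : #|[set u : vtx S * vtx S | nb u.1 u.2]| + 2 = 2 * (#|vtx S| + k);
  lvl_small : forall x : vtx S, lvl x < #|vtx S|;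
  lvl_root : exists x : vtx S, lvl x = 0;
  fbalanced : forall x : vtx S, balanced q (odd (lvl x)) (fdeg x) (fsum x);
  todo_fits : forall x : vtx S,
    all (fits q (~~ odd (lvl x)) (fdeg x)) (todo x)
}.

Lemma sum_option (V : finType) (P : pred (option V)) (F : option V -> nat) :
  \sum_(y | P y) F y = (if P None then F None else 0) + \sum_(x | P (Some x)) F (Some x).
Proof.
rewrite big_mkcond (bigD1 None) //=; congr (_ + _).
rewrite -big_mkcondr /= (reindex_omap Some id) /=; last by case.
by apply: eq_bigl => x; rewrite eqxx andbT.
Qed.

(** The new vertex, [None], is placed at level [l] with pending trees [ch]. *)
Section Grow.
Variables (S : stage) (A : {set vtx S}) (l : nat) (ch : seq tree).

Definition grow_nb (x y : option (vtx S)) : bool :=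
  match x, y with
  | Some x, Some y => nb x y
  | Some x, None | None, Some x => x \in A
  | None, None => false
  end.

Definition grow : stage :=
  @Stage (option (vtx S)) grow_nb
    (fun x => if x is Some x then lvl x else l)
    (fun x => if x is Some x
              then if x \in A then behead (todo x) else todo x
              else ch).

(* The new vertex takes the place of the first pending tree at each vertex of
   [A], whose root was to have the same final degree. *)
Hypothesis todoA : forall x, x \in A ->
  exists t, todo x = t :: behead (todo x) /\ tdeg t = #|A| + size ch.

Lemma grow_fdegS x : @fdeg grow (Some x) = fdeg x.
Proof.
rewrite /fdeg -!sum1dep_card sum_option /=.
case: ifP => [/todoA [t [-> _]]|_] /=; lia.
Qed.

Lemma grow_fdegN : @fdeg grow None = #|A| + size ch.
Proof.
by rewrite /fdeg -!sum1dep_card sum_option /= add0n sum1_card.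
Qed.

Lemma grow_fsumS x : @fsum grow (Some x) = fsum x.
Proof.
rewrite /fsum sum_option /= grow_fdegN.
under eq_bigr do rewrite grow_fdegS.
case: ifP => [/todoA [t [e et]]|_] //.
by rewrite [in RHS]e /tdegs /= et; lia.
Qed.

Lemma grow_fsumN : @fsum grow None = \sum_(x in A) fdeg x + tdegs ch.
Proof.
rewrite /fsum sum_option /= add0n.
by under eq_bigr do rewrite grow_fdegS.
Qed.

Lemma grow_count :
  #|[set u : vtx grow * vtx grow | nb u.1 u.2]|
  = #|[set u : vtx S * vtx S | nb u.1 u.2]| + 2 * #|A|.
Proof.
rewrite -!sum1dep_card -!(pair_big_dep xpredT (fun x y => nb x y) (fun _ _ => 1)) /=.
rewrite sum_option /= sum_option /= add0n sum1_card.
under eq_bigr do rewrite sum_option /=.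
by rewrite big_split /= -big_mkcond /= sum1_card; lia.
Qed.

(** The vertices already present are unaffected because the new vertex has the
    degree that they had reserved for it; only the new vertex has to be checked.
    It adds one vertex and [#|A|] edges. *)
Lemma grow_sound (q k : nat) :
  sound q k S -> A != set0 -> (forall x, x \in A -> l = (lvl x).+1) ->
  balanced q (odd l) (#|A| + size ch) (\sum_(x in A) fdeg x + tdegs ch) ->
  all (fits q (~~ odd l) (#|A| + size ch)) ch ->
  sound q (k + #|A|.-1) grow.
Proof.
move=> H /set0Pn [a aA] Al bal fit.
have connS x y : connect (@nb grow) (Some x) (Some y).
  have /connectP [p xp ->] := nb_connected H x y.
  apply/connectP; exists (map Some p); last by rewrite last_map.
  by rewrite path_map.
have toN x : connect (@nb grow) (Some x) None.
  by apply: connect_trans (connS x a) _; apply: connect1.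
have fromN x : connect (@nb grow) None (Some x).
  by apply: connect_trans (connS a x); apply: connect1.
have A0 : 0 < #|A| by apply/card_gt0P; exists a.
split.
- by move=> [x|] [y|] //=; apply: nb_sym H _ _.
- move=> [x|] [y|] //=; first exact: nb_lvl H _ _.
    by move=> /Al ->; rewrite eqxx.
  by move=> /Al ->; rewrite eqxx orbT.
- by move=> [x|] [y|].
- have := nb_count H; rewrite grow_count card_option; lia.
- have sm := lvl_small H.
  case=> [x|] /=; rewrite card_option; first exact: leq_trans (sm x) _.
  by rewrite (Al a aA) ltnS.
- by have [x x0] := lvl_root H; exists (Some x).
- case=> [x|] /=; first by rewrite grow_fdegS grow_fsumS; apply: fbalanced H _.
  by rewrite grow_fdegN grow_fsumN.
- case=> [x|] /=; last by rewrite grow_fdegN.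
  rewrite grow_fdegS; have := todo_fits H x.
  by case: ifP => // _; case: (todo x) => //= t s /andP [].
Qed.

End Grow.

Definition todo_size (S : stage) := \sum_(x : vtx S) sumn (map tsize (todo x)).

(** Only the root of the tree becomes a vertex: its subtrees remain pending. *)
Definition hang (S : stage) (x : vtx S) (t : tree) :=
  @grow S [set x] (lvl x).+1 (children t).

Section Hang.
Variables (q k : nat) (S : stage) (x : vtx S) (t : tree) (s : seq tree).
Hypotheses (H : sound q k S) (xt : todo x = t :: s).

Lemma hang_todo y : y \in [set x] ->
  exists t', todo y = t' :: behead (todo y) /\ tdeg t' = #|[set x]| + size (children t).
Proof. by move=> /set1P ->; exists t; rewrite xt cards1. Qed.

Lemma hang_sound : sound q k (hang x t).
Proof.
have -> : k = k + #|[set x]|.-1 by rewrite cards1 addn0.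
have := todo_fits H x; rewrite xt /= => /andP [+ _].
case: t xt => ch xch /= /andP [bal fit].
apply: grow_sound => //=.
- by move=> y /set1P ->; exists (Node ch); rewrite xch cards1.
- by apply/set0Pn; exists x; rewrite set11.
- by move=> y /set1P ->.
- by rewrite big_set1 cards1.
- by rewrite cards1.
Qed.

Lemma hang_size : todo_size S = (todo_size (hang x t)).+1.
Proof.
rewrite /todo_size sum_option /= (bigD1 x) //= [in RHS](bigD1 x) //= set11 xt /=.
under [in RHS]eq_bigr => y /negPf yx do rewrite inE yx.
by case: t => ch /=; lia.
Qed.

End Hang.

(** Hanging one root at a time terminates, since the total size of the pending
    trees drops by one, and it creates no cycle. *)
Lemma completion q k d (S : stage) : sound q k S -> (exists x : vtx S, d <= lvl x) ->
  exists S' : stage, [/\ sound q k S', forall x : vtx S', todo x = [::]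
    & exists x : vtx S', d <= lvl x].
Proof.
have [n] := ubnP (todo_size S); elim: n S => // n IH S le_n H [y yd].
case: (pickP (fun x : vtx S => 0 < size (todo x))) => [x|todo0].
  case xt: (todo x) => [//|t s] _.
  apply: (IH (hang x t)); last by exists (Some y).
    by move: le_n; rewrite (hang_size xt).
  exact: hang_sound xt.
exists S; split=> // [x|]; last by exists y.
by case: (todo x) (todo0 x).
Qed.

(** * Balanced trees and the spine *)

Lemma fits_node q s p ch : fits q s p (Node ch) =
  balanced q s (size ch).+1 (p + tdegs ch) && all (fits q (~~ s) (size ch).+1) ch.
Proof. by []. Qed.

Lemma balanced_odd q d n :
  balanced q true d n = (n + d ^ 2 + 1 + q == (q ^ 2 + q + 3) * d).
Proof. by rewrite /balanced mul1n. Qed.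

Lemma balanced_even q d n :
  balanced q false d n = (n + d ^ 2 + 1 == (q ^ 2 + q + 3) * d).
Proof. by rewrite /balanced mul0n addn0. Qed.

Definition balancedE := (balanced_odd, balanced_even).

Lemma tdegs_nil : tdegs [::] = 0.
Proof. by []. Qed.

Section Spine.
(* The form [m.+2] of the parameter avoids subtractions: [m.+1] is [r - 1],
   [q * m] is [r^2 - 2 r], and [q * m.+1] is [r^2 - r]. *)
Variable m : nat.
Notation q := m.+2.

Definition leaf := Node [::].
Definition star := Node (nseq (q ^ 2 + q) leaf).
Definition branch_end := Node (nseq q star ++ nseq (q * m.+1) leaf).
Definition hub := Node (nseq q branch_end).

(** The pending trees of a spine vertex: [r - 1] stars and [r^2 - 2 r] leaves,
    besides those hubs among its [r + 2] that are not yet in the graph. *)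
Definition spine_rest := nseq m.+1 star ++ nseq (q * m) leaf.
Definition spine_todo j := nseq j hub ++ spine_rest.

Lemma tdegs_cat s1 s2 : tdegs (s1 ++ s2) = tdegs s1 + tdegs s2.
Proof. by rewrite /tdegs map_cat sumn_cat. Qed.

Lemma tdegs_nseq n t : tdegs (nseq n t) = tdeg t * n.
Proof. by rewrite /tdegs map_nseq sumn_nseq. Qed.

Lemma tdegE : (tdeg leaf = 1) * (tdeg star = q ^ 2 + q + 1)
  * (tdeg branch_end = q ^ 2 + 1) * (tdeg hub = q.+1).
Proof.
rewrite /tdeg /leaf /star /branch_end /hub /children.
by rewrite size_cat !size_nseq; split; [split; [split|]|] => //; lia.
Qed.

Definition fitsE :=
  (all_cat, all_nseq, tdegs_cat, tdegs_nseq, size_cat, size_nseq, tdegE).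

Lemma leaf_fits_odd : fits q true (q ^ 2 + 1) leaf.
Proof. by rewrite /leaf fits_node andbT balancedE tdegs_nil /size; lia. Qed.

Lemma leaf_fits_even : fits q false (q ^ 2 + q + 1) leaf.
Proof. by rewrite /leaf fits_node andbT balancedE tdegs_nil /size; lia. Qed.

Lemma star_fits : fits q true (q ^ 2 + 1) star.
Proof.
rewrite /star fits_node !fitsE -[(q ^ 2 + q).+1]addn1 leaf_fits_even orbT.
by rewrite balancedE; lia.
Qed.

Lemma branch_end_fits : fits q false q.+1 branch_end.
Proof.
rewrite /branch_end fits_node !fitsE.
have -> : (q + q * m.+1).+1 = q ^ 2 + 1 by lia.
by rewrite leaf_fits_odd star_fits !orbT balancedE; lia.
Qed.

Lemma hub_fits : fits q true (q ^ 2 + 1) hub.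
Proof.
by rewrite /hub fits_node !fitsE branch_end_fits orbT balancedE; lia.
Qed.

Lemma spine_todo_fits j : all (fits q true (q ^ 2 + 1)) (spine_todo j).
Proof. by rewrite /spine_todo /spine_rest !fitsE leaf_fits_odd star_fits hub_fits !orbT. Qed.

Lemma size_spine_todo i j : i + j = q + 2 -> i + size (spine_todo j) = q ^ 2 + 1.
Proof. by rewrite /spine_todo /spine_rest !fitsE; lia. Qed.

(** Here [i] of the hubs around the spine vertex are already present. *)
Lemma spine_balanced i j : i + j = q + 2 ->
  balanced q false (q ^ 2 + 1) (i * q.+1 + tdegs (spine_todo j)).
Proof.
rewrite /spine_todo /spine_rest !fitsE balancedE => e.
have -> : i = q + 2 - j by lia.
have : j <= q + 2 by lia.
move: e => _ /subnK => e; move: (q + 2 - j) e => i' e.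
have -> : i' * q.+1 + (q.+1 * j + ((q ^ 2 + q + 1) * m.+1 + 1 * (q * m)))
  = (i' + j) * q.+1 + ((q ^ 2 + q + 1) * m.+1 + q * m) by lia.
by rewrite e; lia.
Qed.

(** A spine vertex at level [d] or beyond with two hubs still pending, as
    required to close another cycle. *)
Definition spine_end k d : Prop :=
  exists (S : stage) (x : vtx S) (s : seq tree),
    [/\ sound q k S, d <= lvl x, odd (lvl x) = false, fdeg x = q ^ 2 + 1
      & todo x = hub :: hub :: s].

Lemma spine_start : spine_end 0 0.
Proof.
pose S := @Stage unit (fun _ _ => false) (fun _ => 0) (fun _ => spine_todo (q + 2)).
have deg0 (x : vtx S) : #|[set y : vtx S | nb x y]| = 0.
  by apply: eq_card0 => y; rewrite inE.
have degx (x : vtx S) : fdeg x = q ^ 2 + 1.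
  by rewrite /fdeg deg0 size_spine_todo.
exists S, tt, (spine_todo q); split=> //; last by rewrite /= addn2.
split=> //.
- by case; case; apply: connect0.
- rewrite eq_card0 ?card_unit //; by move=> u; rewrite inE.
- by move=> x; rewrite card_unit.
- by exists tt.
- move=> x; rewrite degx /fsum big_pred0 // -[0]/(0 * q.+1).
  exact: spine_balanced.
- by move=> x; rewrite degx; apply: spine_todo_fits.
Qed.

(** The next spine vertex, joined to the hubs in [A], replaces a pending branch
    end at each of them; both kinds of vertices have the degree [r^2+1], which
    is all that a hub sees.  At most two hubs may be used, so that the new spine
    vertex keeps at least [r + 2 - 2 >= 2] pending hubs. *)
Lemma join_spine k d (S : stage) (A : {set vtx S}) : sound q k S ->
  0 < #|A| <= 2 -> ~~ odd d ->
  (forall y, y \in A -> exists s, [/\ todo y = branch_end :: s, fdeg y = q.+1 & lvl y = d.+1]) ->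
  spine_end (k + #|A|.-1) d.+2.
Proof.
move=> H /andP [A0 A2] d_even HA.
pose j := q + 2 - #|A|.
have ij : #|A| + j = q + 2 by rewrite /j; lia.
have szj : #|A| + size (spine_todo j) = q ^ 2 + 1 by apply: size_spine_todo.
have SA : sound q (k + #|A|.-1) (grow A d.+2 (spine_todo j)).
  apply: grow_sound => //.
  - by move=> y /HA [s [-> _ _]]; exists branch_end; rewrite tdegE szj.
  - by rewrite -card_gt0.
  - by move=> y /HA [s [_ _ ->]].
  - rewrite szj /= negbK (negbTE d_even).
    under eq_bigr => y /HA [s [_ -> _]] do [].
    by rewrite sum_nat_const; apply: spine_balanced.
  - by rewrite szj /= negbK d_even; apply: spine_todo_fits.
exists (grow A d.+2 (spine_todo j)), None, (spine_todo (q - #|A|)); split=> //.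
- by rewrite /= negbK (negbTE d_even).
- by rewrite grow_fdegN.
- have -> : j = (q - #|A|).+2 by rewrite /j; lia.
  by [].
Qed.

Lemma hang_hub k (S : stage) (x : vtx S) s :
  sound q k S -> todo x = hub :: s ->
  sound q k (hang x hub)
  /\ forall z : vtx (hang x hub),
    match z with
    | None => [/\ todo z = branch_end :: nseq m.+1 branch_end, fdeg z = q.+1 & lvl z = (lvl x).+1]
    | Some y => [/\ todo z = if y == x then s else todo y, fdeg z = fdeg y & lvl z = lvl y]
    end.
Proof.
move=> H xs; split; first exact: hang_sound xs.
have xA y : y \in [set x] -> exists t, todo y = t :: behead (todo y)
    /\ tdeg t = #|[set x]| + size (children hub).
  by move=> yx; have := hang_todo xs yx.
case=> [y|]; split=> //.
- by rewrite /= in_set1; case: eqP => // ->; rewrite xs.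
- exact: grow_fdegS xA _.
- by apply: etrans (grow_fdegN _ _ _) _; rewrite cards1 size_nseq.
Qed.

Lemma spine_longer k d : spine_end k d -> spine_end k d.+1.
Proof.
move=> [S [x [s [H dx x_even degx xs]]]].
have [H1 Hz] := hang_hub H xs.
pose n : vtx (hang x hub) := None.
have [] := @join_spine k (lvl x) _ [set n] H1; rewrite ?cards1 ?x_even //.
  by move=> y /set1P ->; have [] := Hz None; exists (nseq m.+1 branch_end).
move=> S' [y [s' [H' ly y_even degy ys]]].
rewrite addn0 in H'.
by exists S', y, s'; split=> //; apply: leq_trans ly; rewrite ltnS leqW.
Qed.

Lemma spine_cycle k d : spine_end k d -> spine_end k.+1 d.
Proof.
move=> [S [x [s [H dx x_even degx xs]]]].
have [H1 H1z] := hang_hub H xs.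
have [x1 _ lx] := H1z (Some x); rewrite eqxx in x1.
have [H2 H2z] := hang_hub H1 x1.
pose n1 : vtx (hang (Some x : vtx (hang x hub)) hub) := Some None.
pose n2 : vtx (hang (Some x : vtx (hang x hub)) hub) := None.
have A2 : #|[set n1; n2]| = 2 by rewrite cards2.
have [] := @join_spine k (lvl x) _ [set n1; n2] H2; rewrite ?A2 ?x_even //.
  move=> y /set2P [] ->; exists (nseq m.+1 branch_end).
    by have [-> -> ->] := H2z n1; have [] := H1z None.
  by have [] := H2z n2; rewrite lx.
move=> S' [y [s' [H' ly y_even degy ys]]].
rewrite addn1 in H'.
by exists S', y, s'; split=> //; apply: leq_trans ly; rewrite leqW // leqW.
Qed.

Lemma spine_exists k d : spine_end k d.
Proof.
elim: d => [|d]; last exact: spine_longer.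
by elim: k => [|k]; [exact: spine_start | exact: spine_cycle].
Qed.

Lemma stage_exists k d : exists S : stage,
  [/\ sound q k S, forall x : vtx S, todo x = [::] & exists x : vtx S, d <= lvl x].
Proof.
have [S [x [_ [H dx _ _ _]]]] := spine_exists k d.
by apply: completion H _; exists x.
Qed.

End Spine.

(** * Balanced graphs with given cyclomatic number and large diameter *)

Definition locally_balanced (q : nat) (G : graph) (Vp : {set G}) : Prop :=
  forall x : G, nbdeg x + deg x ^ 2 + 1 + (if x \in Vp then 0 else q)
    = (q ^ 2 + q + 3) * deg x.

(** The levels of a stage provide everything: their parity is the bipartition,
    they bound the diameter from below, and, being smaller than the number of
    vertices, they bound the order as well. *)
Lemma graph_exists (q k d : nat) : 1 < q ->
  exists (G : graph) (Vp : {set G}),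
    [/\ bipartition Vp, locally_balanced q Vp, cyclomatic G = k,
        d <= diameter G & d < #|G|].
Proof.
case: q => [|[|m]] // _.
have [S [H todo0 [z dz]]] := stage_exists m k d.
have [x0 lx0] := lvl_root H.
have fdegE (x : vtx S) : fdeg x = #|[set y | nb x y]|.
  by rewrite /fdeg todo0 addn0.
have irr : irreflexive (@nb S).
  by move=> x; apply/negP => /(nb_lvl H); lia.
(* An isolated vertex would have [d = s = 0], which is not balanced. *)
have edge : exists x y : vtx S, nb x y.
  have := fbalanced H x0; rewrite /balanced fdegE.
  case: (pickP (nb x0)) => [y xy|none]; first by exists x0, y.
  by rewrite (eq_card0 (A := mem [set _ | _])) ?muln0 => [|y]; rewrite ?inE ?none //; lia.
pose G := Graph (nb_sym H) irr (nb_connected H) edge.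
have degE (x : G) : deg x = fdeg (x : vtx S) by rewrite fdegE.
pose Vp : {set G} := [set x : vtx S | ~~ odd (lvl x)].
have step (x y : G) : adj x y -> lvl (y : vtx S) <= (lvl (x : vtx S)).+1.
  by move=> /(nb_lvl H); lia.
exists G, Vp; split.
- by move=> x y /(nb_lvl H) /orP [] /eqP e; rewrite !inE e /= negbK; case: odd.
- move=> x; have := fbalanced H x; rewrite /balanced /fsum todo0 addn0 => /eqP.
  rewrite -degE /nbdeg (eq_bigr _ (fun y _ => degE y)) => <-.
  by rewrite inE if_neg; case: odd; rewrite ?mul1n.
- have := nb_count H; have := handshake G; rewrite /cyclomatic /=.
  move: #|edges G| #|[set _ | _]| #|_| => e c v; lia.
- by have := @diameter_ge G _ x0 z step; rewrite lx0 add0n; apply: leq_trans.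
- exact: leq_ltn_trans dz (lvl_small H z).
Qed.

Local Open Scope ring_scope.

(** * The signless Laplacian applied to vertex functions *)

Section SpectralFacts.
Variables (R : realType) (G : graph).
Local Notation Q := (Qmx R G).

Lemma sum_enum_val (F : G -> R) : \sum_(i < #|G|) F (enum_val i) = \sum_x F x.
Proof. by rewrite -big_enum_val. Qed.

(** Matrices over [G] are indexed by [enum_val]; [cvec] hides this indexing. *)
Definition cvec (f : G -> R) : 'cV[R]_#|G| := \col_i f (enum_val i).

Lemma eq_cvec f g : f =1 g -> cvec f = cvec g.
Proof. by move=> e; apply/colP => i; rewrite !mxE e. Qed.

Lemma Qmx_cvec f :
  Q *m cvec f = cvec (fun x => \sum_(y | adj x y) f y + (deg x)%:R * f x).
Proof.
rewrite mulmxDl mul_diag_mx; apply/colP => i; rewrite !mxE; congr (_ + _).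
rewrite [RHS]big_mkcond -[RHS]sum_enum_val; apply: eq_bigr => j _.
by rewrite !mxE; case: ifP => _; rewrite ?mul1r ?mul0r.
Qed.

Lemma Qmx_sym : Q^T = Q.
Proof.
rewrite linearD /= tr_diag_mx; congr (_ + _).
by apply/matrixP => i j; rewrite !mxE adj_sym.
Qed.

Lemma cvec_dot f g : (cvec f)^T *m cvec g = (\sum_x f x * g x)%:M.
Proof.
rewrite [LHS]mx11_scalar mxE -[X in _ = X%:M]sum_enum_val; congr (_%:M).
by apply: eq_bigr => i _; rewrite !mxE.
Qed.

Lemma onesE : ones R G = cvec (fun=> 1).
Proof. by apply/colP => i; rewrite !mxE. Qed.

Lemma sign_vectorE Vp : sign_vector R Vp = cvec (fun x => if x \in Vp then 1 else -1).
Proof. by apply/colP => i; rewrite !mxE. Qed.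

Lemma Q_ones : Q *m ones R G = cvec (fun x => 2 * (deg x)%:R).
Proof.
rewrite onesE Qmx_cvec; apply: eq_cvec => x.
by rewrite sumr_const mulr1 mulr_natl mulr2n /deg cardsE.
Qed.

Lemma Q2_ones :
  Q *m (Q *m ones R G) = cvec (fun x => 2 * ((nbdeg x)%:R + (deg x)%:R ^+ 2)).
Proof.
rewrite Q_ones Qmx_cvec; apply: eq_cvec => x.
by rewrite -mulr_sumr natr_sum; ring.
Qed.

Lemma signed_degree_sumP (a b t : int) (Vp : {set G}) :
  signed_degree_sum R a b t Vp <->
  forall x, 2 * ((nbdeg x)%:R + (deg x)%:R ^+ 2) - a%:~R * (2 * (deg x)%:R) + b%:~R
    = t%:~R * (if x \in Vp then 1 else -1) :> R.
Proof.
rewrite /signed_degree_sum Q2_ones Q_ones onesE sign_vectorE; split.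
  by move=> /colP e x; have := e (enum_rank x); rewrite !mxE enum_rankK mulr1.
by move=> e; apply/colP => i; rewrite !mxE mulr1.
Qed.

Lemma Q_sign Vp : bipartition Vp -> Q *m sign_vector R Vp = 0.
Proof.
move=> bip; rewrite sign_vectorE Qmx_cvec; apply/colP => i; rewrite !mxE.
set x := enum_val i.
rewrite (eq_bigr (fun=> - (if x \in Vp then 1 else -1))).
  by rewrite sumr_const mulr_natl /deg cardsE mulNrn addNr.
by move=> y /bip; do 2!case: (_ \in Vp) => //=; rewrite opprK.
Qed.

(** Eigenspaces are defined by row vectors, hence the transposition; [Q] being
    symmetric, column eigenvectors serve as well. *)
Lemma Qmain_vec (lam : R) f : Q *m cvec f = lam *: cvec f ->
  \sum_x f x != 0 -> Qmain G lam.
Proof.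
move=> Qf f1.
have eig : (cvec f)^T *m Q = lam *: (cvec f)^T.
  by rewrite -{1}Qmx_sym -trmx_mul Qf linearZ.
have f1' : (cvec f)^T *m ones R G != 0.
  rewrite onesE cvec_dot; under eq_bigr do rewrite mulr1.
  by apply: contra f1 => /eqP /matrixP /(_ 0 0); rewrite !mxE mulr1n => ->.
apply/andP; split.
  apply/eigenvalueP; exists (cvec f)^T => //.
  by apply: contraNneq f1' => ->; rewrite mul0mx.
have /submxP [D fD] : ((cvec f)^T <= eigenspace Q lam)%MS by apply/eigenspaceP.
by apply: contraNneq f1' => e0; rewrite fD -mulmxA e0 mulmx0.
Qed.

End SpectralFacts.

(** * Q-main eigenvalues under a signed degree-sum equation *)

Section Signed.
Variables (R : realType) (G : graph) (a b t : int) (Vp : {set G}).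
Local Notation Q := (Qmx R G).
Local Notation one := (ones R G).
Local Notation sgn := (fun x : G => if x \in Vp then 1 else -1 : R).
Hypotheses (bip : bipartition Vp) (sds : signed_degree_sum R a b t Vp).

Definition main_cubic : {poly R} := 'X * ('X^2 - a%:~R *: 'X + b%:~R%:P).

Lemma Q_cubic :
  Q *m (Q *m (Q *m one)) - a%:~R *: (Q *m (Q *m one)) + b%:~R *: (Q *m one)
    = 0.
Proof.
have := congr1 (mulmx Q) sds.
by rewrite mulmxDr mulmxBr -!scalemxAr Q_sign // scaler0.
Qed.

Lemma main_cubicE x : main_cubic.[x] = x * (x ^+ 2 - a%:~R * x + b%:~R).
Proof. by rewrite /main_cubic !hornerE. Qed.

(** If the rows of [u] span the eigenspace of [x], then [u *m p(Q) *m 1] equals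
    [p(x) *: (u *m 1)], and the cubic [p] annihilates [1]. *)
Lemma Qmain_root x : Qmain G x -> root main_cubic x.
Proof.
case/andP=> _ u1; set u := eigenspace Q x in u1.
have uQ n (z : 'M_(_, n)) : u *m (Q *m z) = x *: (u *m z).
  by rewrite mulmxA (eigenspaceP (submx_refl u)) -scalemxAl.
have := congr1 (mulmx u) Q_cubic.
rewrite mulmxDr mulmxBr -!scalemxAr !uQ mulmx0 !scalerA -scalerBl -scalerDl.
move/eqP; rewrite scaler_eq0 (negPf u1) orbF => /eqP e.
by rewrite /root main_cubicE -e; apply/eqP; ring.
Qed.

Lemma size_lower_terms :
  (size (- (a%:~R *: 'X) + b%:~R%:P : {poly R})%R < size ('X^2 : {poly R})%R)%N.
Proof.
rewrite size_polyXn ltnS (leq_trans (size_polyD _ _)) // geq_max size_polyN.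
rewrite (leq_trans (size_scale_leq _ _)) ?size_polyX //.
by rewrite (leq_trans (size_polyC_leq1 _)).
Qed.

Lemma size_main_cubic : size main_cubic = 4%N.
Proof.
have s2 : size ('X^2 - a%:~R *: 'X + b%:~R%:P : {poly R}) = 3%N.
  by rewrite -addrA size_polyDl ?size_polyXn // -(size_polyXn R 2) size_lower_terms.
by rewrite /main_cubic mulrC size_mulX -?size_poly_eq0 s2.
Qed.

Lemma main_cubic_monic : main_cubic \is monic.
Proof.
rewrite /main_cubic monicMr ?monicX // -addrA monicE.
by rewrite lead_coefDl ?lead_coefXn // size_lower_terms.
Qed.

Lemma Qmain_poly_cubic : size (Qmain_eigenvalues R G) = 3%N -> Qmain_poly R G = main_cubic.
Proof.
move=> s3; rewrite (@all_roots_prod_XsubC _ main_cubic (Qmain_eigenvalues R G)).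
- by rewrite (monicP main_cubic_monic) scale1r.
- by rewrite size_main_cubic s3.
- by apply/allP => x; rewrite mem_Qmain_eigenvalues; apply: Qmain_root.
- by rewrite uniq_rootsE Qmain_eigenvalues_uniq.
Qed.

Lemma sum_sgn : \sum_x sgn x = #|Vp|%:R - #|~: Vp|%:R.
Proof.
rewrite (bigID (mem Vp)) /= (eq_bigr (fun=> 1)) => [|x -> //].
rewrite sumr_const; congr (_ + _).
rewrite (eq_bigr (fun=> -1)) => [|x /negPf -> //].
by rewrite sumr_const mulNrn -cardsE; do 2!congr (- _%:R); apply: eq_card => x; rewrite !inE.
Qed.

(** The sign vector is orthogonal to the image of [Q], so pairing it with the
    equation leaves only the term in [1]. *)
Lemma sign_balance : b%:~R * (#|Vp|%:R - #|~: Vp|%:R) = t%:~R * #|G|%:R :> R.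
Proof.
have sQ (z : 'cV_#|G|) : (sign_vector R Vp)^T *m (Q *m z) = 0.
  by rewrite mulmxA -{1}Qmx_sym -trmx_mul Q_sign // trmx0 mul0mx.
have := congr1 (mulmx (sign_vector R Vp)^T) sds.
rewrite mulmxDr mulmxBr -!scalemxAr !sQ scaler0 subr0 add0r.
rewrite onesE sign_vectorE !cvec_dot.
move=> /matrixP /(_ 0 0); rewrite !mxE !mulr1n.
under eq_bigr do rewrite mulr1.
rewrite sum_sgn => ->; congr (_ * _).
rewrite (eq_bigr (fun=> 1)) ?sumr_const // => x _.
by case: ifP => _; rewrite ?mulr1 // mulrNN mulr1.
Qed.

Lemma Qmain0 : #|Vp| != #|~: Vp| -> Qmain G (0 : R).
Proof.
move=> neq; apply: (@Qmain_vec _ _ _ sgn).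
  by rewrite -sign_vectorE Q_sign // scale0r.
by rewrite sum_sgn subr_eq0 eqr_nat.
Qed.

(** The vector [f = Q (Q - mu) 1] is a multiple of the projection of [1] to the
    eigenspace of [lam].  If this eigenvalue is not main, then [f] is orthogonal
    to [1], hence to itself: [(f, f) = lam (lam - mu) (f, 1)].  The alternative
    in the conclusion is [f = 0]. *)
Lemma Qmain_or_proportional (lam mu : R) : lam + mu = a%:~R -> lam * mu = b%:~R ->
  Qmain G lam \/ forall x : G, (nbdeg x)%:R + (deg x)%:R ^+ 2 = mu * (deg x)%:R.
Proof.
move=> eab eb; pose f (x : G) : R :=
  2 * ((nbdeg x)%:R + (deg x)%:R ^+ 2) - mu * (2 * (deg x)%:R).
have fE : cvec f = Q *m (Q *m one) - mu *: (Q *m one).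
  by rewrite Q2_ones Q_ones; apply/colP => i; rewrite !mxE.
have Qf : Q *m cvec f = lam *: cvec f.
  have := Q_cubic; rewrite fE -eab -eb mulmxBr -scalemxAr.
  move: (Q *m one) (Q *m (Q *m one)) (Q *m (Q *m (Q *m one))) => v1 v2 v3.
  move=> /colP e; apply/colP => i; have := e i; rewrite !mxE => {}e.
  by apply/eqP; rewrite -subr_eq0 -[X in _ == X]e; apply/eqP; ring.
case: (eqVneq (\sum_x f x) 0) => [f0|]; last by left; apply: Qmain_vec Qf _.
right=> x; suff : f x = 0 by rewrite /f; lra.
have fQ z : (cvec f)^T *m (Q *m z) = lam *: ((cvec f)^T *m z) :> 'M_1.
  by rewrite mulmxA -{1}Qmx_sym -trmx_mul Qf linearZ scalemxAl.
have f1 : (cvec f)^T *m one = 0.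
  by rewrite onesE cvec_dot; under eq_bigr do rewrite mulr1; rewrite f0 raddf0.
have : (cvec f)^T *m cvec f = 0.
  by rewrite {2}fE mulmxBr -scalemxAr !fQ f1 !scaler0 subr0.
rewrite cvec_dot => /matrixP /(_ 0 0); rewrite !mxE mulr1n => ff.
have /(_ x isT) /eqP := psumr_eq0P (fun y _ => sqr_ge0 (f y) : 0 <= f y * f y) ff.
by rewrite mulf_eq0 orbb => /eqP.
Qed.

End Signed.

(** * Balanced graphs belong to the class *)

Section Membership.
Variables (R : realType) (q : nat) (G : graph) (Vp : {set G}).
Hypotheses (q_gt0 : (0 < q)%N) (bip : bipartition Vp) (bal : locally_balanced q Vp).
Notation r := (q%:Z).
Notation a := (r ^+ 2 + r + 3).
Notation b := (r + 2).

Lemma coefE : (a%:~R = (q ^ 2 + q + 3)%N%:R :> R) * (b%:~R = (q + 2)%N%:R :> R).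
Proof. by split; rewrite [RHS]pmulrn; congr (_%:~R); lia. Qed.

Lemma signed_degree_sum_balanced : signed_degree_sum R a b r Vp.
Proof.
apply/signed_degree_sumP => x; rewrite !coefE.
have /(congr1 (fun n => n%:R : R)) := bal x; rewrite !natrD natrX natrM.
by rewrite !natrD -pmulrn; case: ifP => _ e; lra.
Qed.

(** With [c := a - mu], proportionality and balance together say that [d c = 1]
    on [V_+] and [d c = r + 1] on [V_-].  All neighbours of [x] in [V_+] thus have degree [(r + 1) d], and
    balance at [x] reads [(r + 2) d^2 + 1 = (r^2 + r + 3) d]; so [d] divides [1],
    and [r + 3 = r^2 + r + 3]. *)
Lemma not_proportional (mu : R) :
  ~ forall x : G, (nbdeg x)%:R + (deg x)%:R ^+ 2 = mu * (deg x)%:R.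
Proof.
move=> prop; pose c : R := (q ^ 2 + q + 3)%N%:R - mu.
have degc x : (deg x)%:R * c = if x \in Vp then 1 else q.+1%:R.
  have /(congr1 (fun n => n%:R : R)) := bal x.
  rewrite !natrD natrX natrM prop /c -[q.+1]addn1 natrD.
  by case: ifP => _ e; lra.
have [x xVp] : exists x, x \in Vp.
  have [u [v /bip]] := adj_edge G.
  by case: (boolP (u \in Vp)) => [|_ /= vVp]; [exists u | exists v; case: (v \in Vp) vVp].
have xc := degc x; rewrite xVp in xc.
have degy y : adj x y -> deg y = (q.+1 * deg x)%N.
  move=> /bip; rewrite xVp => yVp.
  have yc := degc y; rewrite ifN in yc; last by case: (y \in Vp) yVp.
  have c0 : c != 0 by apply: contraTneq (oner_neq0 R) => c0; rewrite -xc c0 mulr0 eqxx.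
  apply/eqP; rewrite -(eqr_nat R); apply/eqP/(mulIf c0).
  by rewrite yc natrM -mulrA xc mulr1.
have sx : nbdeg x = (deg x * (q.+1 * deg x))%N.
  by rewrite /nbdeg (eq_bigr _ degy) sum_nat_const /deg cardsE.
have := bal x; rewrite xVp sx addn0 => e.
have d1 : (deg x %| 1)%N.
  rewrite -(dvdn_addr 1 (m := deg x * (q.+1 * deg x) + deg x ^ 2)) ?e ?dvdn_mull //.
  by rewrite dvdn_add ?dvdn_mulr // expnS dvdn_mulr.
by move: e; rewrite dvdn1 in d1; rewrite (eqP d1); lia.
Qed.

(** The discriminant of [x^2 - a x + b] is positive and [b] is nonzero, so the
    cubic has three distinct roots, all of which are Q-main. *)
Lemma in_class_balanced : in_class R G a b r.
Proof.
have sds := signed_degree_sum_balanced.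
have cards : (#|~: Vp| < #|Vp|)%N.
  have := sign_balance bip sds; rewrite !coefE -pmulrn => e.
  rewrite -(ltr_nat R) -subr_gt0 -(pmulr_rgt0 _ (x := (q + 2)%N%:R)) ?ltr0n ?addn2 // -[q.+2]addn2 e.
  rewrite -natrM ltr0n muln_gt0 q_gt0 /=.
  by have [x _] := adj_edge G; apply/card_gt0P; exists x.
pose A : R := (q ^ 2 + q + 3)%N%:R; pose B : R := (q + 2)%N%:R.
have B0 : 0 < B by rewrite /B ltr0n addn2.
have disc : 0 < A ^+ 2 - 4 * B.
  by rewrite /A /B subr_gt0 -natrX -natrM ltr_nat; nia.
pose s := Num.sqrt (A ^+ 2 - 4 * B).
have s0 : 0 < s by rewrite sqrtr_gt0.
have ss : s ^+ 2 = A ^+ 2 - 4 * B by rewrite sqr_sqrtr // ltW.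
pose lam := (A + s) / 2; pose mu := (A - s) / 2.
have sum : lam + mu = A by rewrite /lam /mu; field.
have prod : lam * mu = B.
  have -> : lam * mu = (A ^+ 2 - s ^+ 2) / 4 by rewrite /lam /mu; field.
  by rewrite ss; field.
have lam_main : Qmain G lam.
  have := @Qmain_or_proportional R G a b r Vp bip sds lam mu.
  by rewrite !coefE => /(_ sum prod) [//|] /not_proportional.
have mu_main : Qmain G mu.
  have := @Qmain_or_proportional R G a b r Vp bip sds mu lam.
  by rewrite !coefE [mu + _]addrC [mu * _]mulrC => /(_ sum prod) [//|] /not_proportional.
have zero_main : Qmain G (0 : R) by apply: (Qmain0 R bip); rewrite gtn_eqF.
have lm : lam != mu by rewrite -subr_eq0 (_ : lam - mu = s) ?gt_eqF // /lam /mu; field.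
have [lam0 mu0] : lam != 0 /\ mu != 0.
  by apply/andP; rewrite -negb_or -mulf_eq0 prod gt_eqF.
split=> //; last by exists Vp.
- apply/eqP; rewrite eqn_leq; apply/andP; split.
    rewrite -ltnS -(size_main_cubic R a b) max_poly_roots ?Qmain_eigenvalues_uniq //.
      by rewrite -size_poly_eq0 size_main_cubic.
    by apply/allP => x; rewrite mem_Qmain_eigenvalues; apply: Qmain_root bip sds _.
  apply: (@uniq_leq_size _ [:: 0; lam; mu]).
    by rewrite /= !inE negb_or ![0 == _]eq_sym lam0 mu0 lm.
  by move=> x; rewrite !inE mem_Qmain_eigenvalues => /or3P [] /eqP ->.
- by rewrite mem_Qmain_eigenvalues.
Qed.

End Membership.

Lemma class_exists (R : realType) (q k d : nat) : (1 < q)%N ->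
  exists G : graph, [/\ in_class_cyc R G k (q%:Z ^+ 2 + q%:Z + 3) (q%:Z + 2) q,
    (d <= diameter G)%N & (d < #|G|)%N].
Proof.
move=> q1; have [G [Vp [bip bal cyc dG cG]]] := graph_exists k d q1.
by exists G; split=> //; split=> //; apply: in_class_balanced bip bal; apply: ltnW.
Qed.

(** Choose each graph to have more vertices than the preceding one. *)
Lemma unbounded_order (P : graph -> Prop) :
  (forall d, exists G, P G /\ (d < #|G|)%N) ->
  exists F : nat -> graph, (forall n, P (F n)) /\
    (forall m n, m <> n -> ~ isomorphic (F m) (F n)).
Proof.
move=> unb; pose g d : graph := sval (cid (unb d)).
have gP d : P (g d) /\ (d < #|g d|)%N := svalP (cid (unb d)).
pose F n := iter n (fun G : graph => g #|G|) (g 0%N).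
have F_lt : {homo (fun n => #|F n|) : m n / (m < n)%N >-> (m < n)%N}.
  by apply: homo_ltn => [|n]; [exact: ltn_trans | have [] := gP #|F n|].
exists F; split=> [n|m n mn /iso_card e].
  by case: n => [|n]; [exact: (gP 0%N).1 | exact: (gP #|F n|).1].
by case: (ltngtP m n) mn => // /F_lt; rewrite e ltnn.
Qed.

Theorem theorem4p5 (R : realType) (k r : int) (hk : 0 <= k) (hr : 2 <= r) :
  [/\ (forall d : nat, exists G : graph,
         in_class_cyc R G k (r ^+ 2 + r + 3) (r + 2) r /\ (d <= diameter G)%N),
      (exists F : nat -> graph,
         (forall n : nat,
            in_class_cyc R (F n) k (r ^+ 2 + r + 3) (r + 2) r) /\
         (forall m n : nat, m <> n -> ~ isomorphic (F m) (F n)))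
    & forall G : graph,
        in_class_cyc R G k (r ^+ 2 + r + 3) (r + 2) r ->
        Qmain_poly R G =
          'X * ('X^2 - (r ^+ 2 + r + 3)%:~R *: 'X + (r + 2)%:~R%:P)].
Proof.
case: k hk => // k _; case: r hr => // q q2.
have q1 : (1 < q)%N by lia.
split.
- by move=> d; have [G [GP dG _]] := class_exists R k d q1; exists G.
- apply: (unbounded_order (P := fun G => in_class_cyc R G k (q%:Z ^+ 2 + q%:Z + 3) (q%:Z + 2) q)) => d.
  by have [G [GP _ dG]] := class_exists R k d q1; exists G.
- move=> G [[_ s3 _ [Vp [bip _ sds]]] _].
  exact: Qmain_poly_cubic bip sds s3.
Qed.
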